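(* Let $A$ be a bi-quadratic algebra on 3 generators over a field $K$ with parameters $q_1,q_2,q_3\in K^\times$. Suppose that all $q_i\ne 1$, $q_1-q_3\ne 0$ and $1-q_1q_2=0$ (which implies $1-q_2q_3\ne 0$). Then (up to $G_3'$): $$x_2x_1=q_1x_1x_2,\quad x_3x_1=q_1^{-1}x_1x_3,\quad x_3x_2=q_3x_2x_3+\lambda x_1+b_3$$ where $\lambda,b_3\in\{0,1\}$.
   Context: Let $K$ be a field, $K^\times=K\setminus\{0\}$. A bi-quadratic algebra on 3 generators is a $K$-algebra $A$ generated by $x_1,x_2,x_3$ subject to the defining relations $x_2x_1-q_1x_1x_2=ax_1+bx_2+cx_3+b_1$, $x_3x_1-q_2x_1x_3=\alpha x_1+\beta x_2+\gamma x_3+b_2$, $x_3x_2-q_3x_2x_3=\lambda x_1+\mu x_2+\nu x_3+b_3$, where $q_1,q_2,q_3\in K^\times$ and the other coefficients are in $K$, such that the monomials $x_1^ix_2^jx_3^k$ ($i,j,k\ge0$) form a $K$-basis of $A$ (PBW basis). $G_3'$ is the group of changes of generators generated by the affine changes $x_i\mapsto\lambda_ix_i+\mu_i$ ($\lambda_i\in K^\times$, $\mu_i\in K$) and the permutations $x_i\mapsto x_{\sigma(i)}$, $\sigma\in S_3$. ''Up to $G_3'$'' means: after such a change of canonical generators the new canonical generators (again denoted $x_1,x_2,x_3$) have the displayed defining relations (with new parameters denoted by the same letters). *)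

(* Defs.v *)
From HB Require Import structures.
From mathcomp Require Import all_boot all_order all_algebra all_fingroup.

Set Implicit Arguments.
Unset Strict Implicit.
Unset Printing Implicit Defensive.

Import GRing.Theory.
Local Open Scope ring_scope.

Definition i1 : 'I_3 := @Ordinal 3 0 isT.
Definition i2 : 'I_3 := @Ordinal 3 1 isT.
Definition i3 : 'I_3 := @Ordinal 3 2 isT.

Definition is_basis (K : fieldType) (V : lmodType K) (I : eqType) (e : I -> V)
    : Prop :=
  (forall v : V, exists (s : seq I) (c : I -> K), v = \sum_(i <- s) c i *: e i)
  /\ (forall (s : seq I) (c : I -> K), uniq s ->
        \sum_(i <- s) c i *: e i = 0 -> forall i, i \in s -> c i = 0).

Definition pbw_monomial (K : fieldType) (A : algType K) (x : 'I_3 -> A)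
    (n : nat * nat * nat) : A :=
  x i1 ^+ n.1.1 * x i2 ^+ n.1.2 * x i3 ^+ n.2.

Definition pbw_basis (K : fieldType) (A : algType K) (x : 'I_3 -> A) : Prop :=
  is_basis (pbw_monomial x).

(* A is the algebra generated by x subject to the defining relations rel,
   expressed by the universal property of K<X1,X2,X3>/(rel).  Only nonzero
   algebras are algTypes, which loses nothing: if the nonzero algebra A
   satisfies rel, then K<X1,X2,X3>/(rel) is itself nonzero. *)
Definition presented_by (K : fieldType)
    (rel : forall B : algType K, ('I_3 -> B) -> Prop)
    (A : algType K) (x : 'I_3 -> A) : Prop :=
  rel A x /\
  forall (B : algType K) (y : 'I_3 -> B), rel B y ->
    exists f : {lrmorphism A -> B},
      (forall i, f (x i) = y i) /\
      (forall g : {lrmorphism A -> B}, (forall i, g (x i) = y i) -> g =1 f).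

Record bq_params (K : fieldType) := BQParams {
  q1 : K; q2 : K; q3 : K;
  pa : K; pb : K; pc : K; b1 : K;
  palpha : K; pbeta : K; pgamma : K; b2 : K;
  plambda : K; pmu : K; pnu : K; b3 : K }.

Definition bq_relations (K : fieldType) (p : bq_params K)
    (B : algType K) (x : 'I_3 -> B) : Prop :=
  [/\ x i2 * x i1 - q1 p *: (x i1 * x i2)
        = pa p *: x i1 + pb p *: x i2 + pc p *: x i3 + (b1 p)%:A,
      x i3 * x i1 - q2 p *: (x i1 * x i3)
        = palpha p *: x i1 + pbeta p *: x i2 + pgamma p *: x i3 + (b2 p)%:A
    & x i3 * x i2 - q3 p *: (x i2 * x i3)
        = plambda p *: x i1 + pmu p *: x i2 + pnu p *: x i3 + (b3 p)%:A].

Definition biquadratic (K : fieldType) (p : bq_params K)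
    (A : algType K) (x : 'I_3 -> A) : Prop :=
  [/\ [/\ q1 p != 0, q2 p != 0 & q3 p != 0],
      presented_by (bq_relations p) x
    & pbw_basis x].

(* G3_change x y: the generators y are obtained from x by an element of G_3'.
   No constructor for inverses is needed, since the inverse of an affine
   change (resp. a permutation) is again one. *)
Inductive G3_change (K : fieldType) (A : algType K) (x : 'I_3 -> A) :
    ('I_3 -> A) -> Prop :=
| G3_id : G3_change x x
| G3_affine (y : 'I_3 -> A) (l m : 'I_3 -> K) :
    G3_change x y -> (forall i, l i != 0) ->
    G3_change x (fun i => l i *: y i + (m i)%:A)
| G3_perm (y : 'I_3 -> A) (s : 'S_3) :
    G3_change x y -> G3_change x (fun i => y (s i)).

(* Main.v *)
(* The two normal forms of x_3 x_2 x_1, obtained by rewriting first x_3 x_2 or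
   first x_2 x_1, have the same coefficients in the PBW basis.  When
   q_1 q_2 = 1, q_1 <> 1 and q_1 <> q_3, these equations say precisely that
   x_j x_i - q x_i x_j = (q - 1) (t_j x_i + t_i x_j + t_i t_j) + r_ij
   for some t_1, t_2, t_3 in K, where q is the parameter of the pair (i, j),
   r_12 = r_13 = 0 and r_23 is in K x_1 + K.  So the generators x_i + t_i have
   q-commutation relations up to r_23, and rescaling the first and the third one
   normalises r_23.  An affine change of generators expresses each new PBW
   monomial triangularly in the old ones, hence preserves the PBW property. *)
Require Import Defs.
From HB Require Import structures.
From mathcomp Require Import all_boot all_order all_algebra all_fingroup.
From mathcomp Require Import ring.

Set Implicit Arguments.
Unset Strict Implicit.
Unset Printing Implicit Defensive.

Import GRing.Theory.
Local Open Scope ring_scope.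

(** * Bases of a vector space and triangular changes of basis *)

Section Bases.
Variables (K : fieldType) (V : lmodType K) (I : eqType).
Implicit Types (e : I -> V) (s : seq (K * I)) (D : pred I).

Lemma sum_regroup e s (r : seq I) : uniq r -> {subset map snd s <= r} ->
  \sum_(u <- s) u.1 *: e u.2
    = \sum_(i <- r) (\sum_(u <- s | u.2 == i) u.1) *: e i.
Proof.
move=> ur sr; under [RHS]eq_bigr => i _ do rewrite scaler_suml big_mkcond.
rewrite exchange_big /= big_seq [RHS]big_seq; apply: eq_bigr => u us.
have ur2 : u.2 \in r by apply/sr/map_f.
rewrite (bigD1_seq u.2) //= eqxx big1 ?addr0 // => i.
by rewrite eq_sym => /negPf ->.
Qed.

(** A list of pairs may repeat an index, so an expansion can be compared as it comes, before like
    terms are collected. *)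
Lemma basis_coef_eq e s s' : is_basis e ->
    \sum_(u <- s) u.1 *: e u.2 = \sum_(u <- s') u.1 *: e u.2 ->
  forall i, \sum_(u <- s | u.2 == i) u.1 = \sum_(u <- s' | u.2 == i) u.1.
Proof.
move=> [_ free_e] /eqP; pose r := undup (map snd (s ++ s')).
have ur : uniq r by rewrite undup_uniq.
have sr : {subset map snd s <= r}.
  by move=> i si; rewrite mem_undup map_cat mem_cat si.
have sr' : {subset map snd s' <= r}.
  by move=> i si; rewrite mem_undup map_cat mem_cat si orbT.
rewrite (sum_regroup _ ur sr) (sum_regroup _ ur sr') -subr_eq0 -sumrB.
under eq_bigr => i _ do rewrite -scalerBl.
move=> /eqP /(free_e r (fun i => _ - _) ur) coef0 i.
have [ri|nri] := boolP (i \in r); first by apply/eqP; rewrite -subr_eq0 coef0.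
have no (t : seq (K * I)) : {subset map snd t <= r} ->
    \sum_(u <- t | u.2 == i) u.1 = 0.
  move=> tr; rewrite big_seq_cond big1 // => u /andP[ut /eqP ui].
  by case/negP: nri; rewrite -ui tr ?map_f.
by rewrite !no.
Qed.

Definition in_span e D (v : V) : Prop :=
  exists2 s, all (fun u => D u.2) s & v = \sum_(u <- s) u.1 *: e u.2.

Lemma in_spanD e D v w : in_span e D v -> in_span e D w -> in_span e D (v + w).
Proof.
by move=> [s Ds ->] [s' Ds' ->]; exists (s ++ s'); rewrite ?all_cat ?Ds // big_cat.
Qed.

Lemma in_spanZ e D c v : in_span e D v -> in_span e D (c *: v).
Proof.
move=> [s Ds ->]; exists [seq (c * u.1, u.2) | u <- s]; first by rewrite all_map.
by rewrite scaler_sumr big_map; apply: eq_bigr => u _; rewrite scalerA.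
Qed.

Lemma in_span_sum e D (J : eqType) (r : seq J) (F : J -> V) :
  (forall j, j \in r -> in_span e D (F j)) -> in_span e D (\sum_(j <- r) F j).
Proof.
move=> DF; rewrite big_seq; apply: big_ind => //; last exact: in_spanD.
by exists [::]; rewrite ?big_nil.
Qed.

Lemma in_span_gen e D i : D i -> in_span e D (e i).
Proof. by move=> Di; exists [:: (1, i)]; rewrite /= ?Di // big_seq1 scale1r. Qed.

Lemma in_span_trans e e' D D' v :
  (forall i, D i -> in_span e' D' (e i)) -> in_span e D v -> in_span e' D' v.
Proof.
move=> ee' [s /allP Ds ->]; apply: in_span_sum => u us.
exact/in_spanZ/ee'/Ds.
Qed.

Lemma basis_notin_span e i : is_basis e -> ~ in_span e (predC1 i) (e i).
Proof.
move=> he [s /allP si es].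
have := @basis_coef_eq e [:: (1, i)] s he _ i.
rewrite big_seq1 scale1r -es => /(_ erefl) /eqP.
rewrite big_cons big_nil /= eqxx addr0 big_seq_cond big1 ?oner_eq0 //.
by move=> u /andP[us ui]; have := si _ us; rewrite /= ui.
Qed.

(** Spanning: strong induction on [deg] solves for each [e i]. Freeness: in a relation among the
    [e' i], an index of maximal degree with nonzero coefficient would put [e i] in the span of the
    other vectors of [e]. *)
Lemma basis_triangular e e' (deg : I -> nat) (d : I -> K) :
    is_basis e -> (forall i, d i != 0) ->
    (forall i, in_span e (fun j => deg j < deg i)%N (e' i - d i *: e i)) ->
  is_basis e'.
Proof.
move=> he d0 ee'; split.
  have e'P i : in_span e' predT (e i).
    have [n] := ubnP (deg i); elim: n i => // n IHn i lt_in.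
    have -> : e i = (d i)^-1 *: (e' i + (-1) *: (e' i - d i *: e i)).
      by rewrite scaleN1r opprB addrC subrK scalerA mulVf ?scale1r.
    apply: in_spanZ; apply: in_spanD; first exact: in_span_gen.
    apply: in_spanZ; apply: in_span_trans (ee' i) => j lt_ji.
    by apply: IHn; apply: leq_trans lt_ji _; rewrite -ltnS.
  move=> v; have [r [c ->]] := he.1 v.
  have [s _ ->] : in_span e' predT (\sum_(i <- r) c i *: e i).
    by apply: in_span_sum => i _; apply: in_spanZ.
  eexists; eexists; apply: (sum_regroup e' (undup_uniq (map snd s))) => i.
  by rewrite mem_undup.
move=> r c ur sum0 i0 ri0; apply/eqP/negPn/negP => c0.
have [i /andP[ri ci] imax] : exists2 i, (i \in r) && (c i != 0) &
    forall j, j \in r -> c j != 0 -> (deg j <= deg i)%N.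
  have ex : exists n, has (fun i => (c i != 0) && (deg i == n)) r.
    by exists (deg i0); apply/hasP; exists i0; rewrite ?c0 /=.
  have bd n : has (fun i => (c i != 0) && (deg i == n)) r ->
      (n <= \max_(i <- r) deg i)%N.
    by case/hasP => i ri /andP[_ /eqP <-]; apply: leq_bigmax_seq.
  case: (ex_maxnP ex bd) => n /hasP[i ri /andP[ci /eqP <-]] nmax.
  exists i; first by rewrite ri.
  by move=> j rj cj; apply/nmax/hasP; exists j; rewrite ?cj /=.
apply: (@basis_notin_span e i he).
(* The relation is solved for [e i]. Since [deg i] is maximal, [e i] occurs neither in the lower
   terms of [e' i] nor in any [e' j] with [j] different from [i] and [c j] nonzero. *)
have -> : e i = - (c i * d i)^-1 *: (\sum_(j <- rem i r) c j *: e' j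
    + c i *: (e' i - d i *: e i)).
  move: sum0; rewrite (perm_big _ (perm_to_rem ri)) big_cons.
  move=> /(canRL (addKr _)) ->.
  rewrite addr0 scalerBr addrA addNr add0r scaleNr scalerN opprK !scalerA.
  by rewrite -?mulrA mulVf ?scale1r // mulf_neq0.
apply: in_spanZ; apply: in_spanD; last first.
  apply: in_spanZ; apply: in_span_trans (ee' i) => j lt_ji.
  by apply: in_span_gen; apply: contraTneq lt_ji => ->; rewrite ltnn.
apply: in_span_sum => j; rewrite mem_rem_uniq // inE => /andP[ji rj].
have [->|cj] := eqVneq (c j) 0.
  by rewrite scale0r; exists [::]; rewrite ?big_nil.
apply: in_spanZ; rewrite -[e' j](subrK (d j *: e j)); apply: in_spanD.
  apply: in_span_trans (ee' j) => k lt_kj; apply: in_span_gen.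
  apply: contraTneq lt_kj => ->; rewrite -leqNgt; exact: imax.
exact/in_spanZ/in_span_gen.
Qed.

End Bases.

(** * Affine changes of generators: PBW monomials and presentations *)

Section AffineChange.
Variables (K : fieldType) (A : algType K).
Implicit Types (x y : 'I_3 -> A).

Lemma exp_affine_lead (l m : K) (u : A) n :
  exists c : nat -> K, (l *: u + m%:A) ^+ n
    = l ^+ n *: u ^+ n + \sum_(k <- iota 0 n) c k *: u ^+ k.
Proof.
have cm : GRing.comm m%:A (l *: u) by rewrite /GRing.comm mulr_algl mulr_algr.
exists (fun k => (m ^+ (n - k) * l ^+ k) *+ 'C(n, k)).
rewrite addrC exprDn_comm // big_ord_recr /= subnn expr0 mul1r binn addrC.
rewrite exprZn; congr (_ + _).
rewrite -[n in iota 0 n]subn0 -/(index_iota 0 n) big_mkord.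
apply: eq_bigr => k _.
by rewrite !exprZn expr1n -scalerAl mul1r scalerA scalerMnl.
Qed.

Definition expo (k : 'I_3) (n : nat * nat * nat) : nat :=
  nth 0%N [:: n.1.1; n.1.2; n.2] k.

(** When a single generator changes, the binomial expansion of its power lowers only its own
    exponent, which therefore serves as the degree of a triangular change. *)
Lemma pbw_basis_affine1 x (k : 'I_3) (l m : K) : l != 0 -> pbw_basis x ->
  pbw_basis (fun i => if i == k then l *: x i + m%:A else x i).
Proof.
move=> l0 hx.
apply: (@basis_triangular _ _ _ _ _ (expo k) (fun n => l ^+ expo k n) hx).
  by move=> n; rewrite expf_neq0.
move=> [[n1 n2] n3]; rewrite /pbw_monomial /expo.
case: k => [[|[|[|//]]] lt_k] /=.
- have [c ->] := exp_affine_lead l m (x i1) n1.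
  rewrite !mulrDl -!scalerAl addrC addKr !mulr_suml.
  apply: in_span_sum => j; rewrite mem_iota => /= lt_j.
  rewrite -!scalerAl; apply: in_spanZ.
  exact: (@in_span_gen _ _ _ (pbw_monomial x) _ (j, n2, n3)).
- have [c ->] := exp_affine_lead l m (x i2) n2.
  rewrite mulrDr mulrDl -!scalerAr -!scalerAl addrC addKr mulr_sumr mulr_suml.
  apply: in_span_sum => j; rewrite mem_iota => /= lt_j.
  rewrite -!scalerAr -!scalerAl; apply: in_spanZ.
  exact: (@in_span_gen _ _ _ (pbw_monomial x) _ (n1, j, n3)).
- have [c ->] := exp_affine_lead l m (x i3) n3.
  rewrite !mulrDr -!scalerAr addrC addKr !mulr_sumr.
  apply: in_span_sum => j; rewrite mem_iota => /= lt_j.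
  rewrite -!scalerAr; apply: in_spanZ.
  exact: (@in_span_gen _ _ _ (pbw_monomial x) _ (n1, n2, j)).
Qed.

Lemma pbw_basis_affine x (l m : 'I_3 -> K) : (forall i, l i != 0) ->
  pbw_basis x -> pbw_basis (fun i => l i *: x i + (m i)%:A).
Proof.
move=> l0 /(@pbw_basis_affine1 _ i1 _ (m i1) (l0 i1)).
move=> /(@pbw_basis_affine1 _ i2 _ (m i2) (l0 i2)).
(* Monomials evaluate generators only at [i1], [i2], [i3], where the index tests compute, so the
   three successive changes are convertible to the full one. *)
by move=> /(@pbw_basis_affine1 _ i3 _ (m i3) (l0 i3)).
Qed.

Lemma presented_by_affine
    (rel rel' : forall B : algType K, ('I_3 -> B) -> Prop)
    x (l m : 'I_3 -> K) : (forall i, l i != 0) ->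
    (forall (B : algType K) (z w : 'I_3 -> B),
       (forall i, w i = l i *: z i + (m i)%:A) -> rel B z <-> rel' B w) ->
  presented_by rel x -> presented_by rel' (fun i => l i *: x i + (m i)%:A).
Proof.
move=> l0 relP [relx univ]; split; first exact/(relP A x).
have affK (B : algType K) (w : B) i :
    l i *: ((l i)^-1 *: (w - (m i)%:A)) + (m i)%:A = w.
  by rewrite scalerA divff // scale1r subrK.
have fE (B : algType K) (f : {lrmorphism A -> B}) i :
    f (l i *: x i + (m i)%:A) = l i *: f (x i) + (m i)%:A.
  by rewrite linearD !linearZ_LR rmorph1.
move=> B w relw.
(* The universal property is applied to the preimage of [w] under the affine change. *)
have /univ[f [fx fU]] : rel B (fun i => (l i)^-1 *: (w i - (m i)%:A)).
  by apply/(relP B _ w) => // i; rewrite affK.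
exists f; split=> [i|g gw]; first by rewrite fE fx affK.
by apply: fU => i; rewrite -gw fE addrK scalerA mulVf ?scale1r.
Qed.

End AffineChange.

(** * Comparing coefficients in the overlap [x3 x2 x1] *)

Section Overlap.
Variables (K : fieldType) (A : algType K).

Lemma overlap_params (x : 'I_3 -> A)
    (q1 q2 q3 a b c b1 al be ga b2 la mu nu b3 : K) :
    pbw_basis x ->
    bq_relations (BQParams q1 q2 q3 a b c b1 al be ga b2 la mu nu b3) x ->
    q1 != 0 -> q3 != 0 -> q1 != 1 -> q1 != q3 -> q2 = q1^-1 ->
  exists t1 t2 t3 : K,
  [/\ [/\ a = t2 * (q1 - 1), b = t1 * (q1 - 1), c = 0
       & b1 = t1 * t2 * (q1 - 1)],
      [/\ al = t3 * (q2 - 1), be = 0, ga = t1 * (q2 - 1)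
       & b2 = t1 * t3 * (q2 - 1)]
    & mu = t3 * (q3 - 1) /\ nu = t2 * (q3 - 1)].
Proof.
move=> hx [] /=.
move=> /eqP; rewrite subr_eq => /eqP r1 /eqP; rewrite subr_eq => /eqP r2.
move=> /eqP; rewrite subr_eq => /eqP r3.
(* Both bracketings are brought to PBW order: the left side starts from [r1], the right side from
   [r3]. *)
have E := mulrA (x i3) (x i2) (x i1).
rewrite r1 r3 !(mulrDl, mulrDr) -!(scalerAl, scalerAr) !mul1r !mulr1 in E.
rewrite mulrA -[x i2 * x i3 * x i1]mulrA !r2 in E.
rewrite !(mulrDl, mulrDr) -!(scalerAl, scalerAr) !mul1r !mulr1 in E.
rewrite -[x i1 * x i3 * x i2]mulrA [x i2 * (x i1 * x i3)]mulrA !r1 !r3 in E.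
rewrite !(mulrDl, mulrDr) -!(scalerAl, scalerAr) !mul1r !mulr1 -?mulrA in E.
pose comb s := \sum_(u <- s) u.1 *: pbw_monomial x u.2.
have combZ k n : k *: pbw_monomial x n = comb [:: (k, n)].
  by rewrite /comb big_seq1.
have combD s s' : comb s + comb s' = comb (s ++ s') by rewrite /comb big_cat.
have combS k s : k *: comb s = comb [seq (k * u.1, u.2) | u <- s].
  rewrite /comb scaler_sumr big_map; apply: eq_bigr => u _.
  by rewrite scalerA.
have m0 : 1 = pbw_monomial x (0, 0, 0)%N.
  by rewrite /pbw_monomial !expr0 !mulr1.
have m1 : x i1 = pbw_monomial x (1, 0, 0)%N.
  by rewrite /pbw_monomial !mulr1.
have m2 : x i2 = pbw_monomial x (0, 1, 0)%N.
  by rewrite /pbw_monomial mul1r mulr1.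
have m3 : x i3 = pbw_monomial x (0, 0, 1)%N.
  by rewrite /pbw_monomial !mul1r.
have m11 : x i1 * x i1 = pbw_monomial x (2, 0, 0)%N.
  by rewrite /pbw_monomial !mulr1.
have m22 : x i2 * x i2 = pbw_monomial x (0, 2, 0)%N.
  by rewrite /pbw_monomial mul1r mulr1.
have m33 : x i3 * x i3 = pbw_monomial x (0, 0, 2)%N.
  by rewrite /pbw_monomial !mul1r.
have m12 : x i1 * x i2 = pbw_monomial x (1, 1, 0)%N.
  by rewrite /pbw_monomial mulr1.
have m13 : x i1 * x i3 = pbw_monomial x (1, 0, 1)%N.
  by rewrite /pbw_monomial mulr1.
have m23 : x i2 * x i3 = pbw_monomial x (0, 1, 1)%N.
  by rewrite /pbw_monomial mul1r.
have m123 : x i1 * (x i2 * x i3) = pbw_monomial x (1, 1, 1)%N.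
  by rewrite /pbw_monomial mulrA.
(* Longer products go first, since rewriting a generator would destroy them. Each side becomes one
   explicit list of coefficients and exponents. *)
rewrite m123 m11 m22 m33 m12 m13 m23 m1 m2 m3 m0 !(combZ, combD, combS) /= in E.
move: {E}(basis_coef_eq hx E) => E.
have := (E (0, 0, 1)%N, E (0, 1, 0)%N, E (0, 1, 1)%N, E (1, 0, 1)%N).
have := (E (1, 1, 0)%N, E (0, 0, 2)%N, E (0, 2, 0)%N).
rewrite {E} unlock /= !addr0 => -[[E110 E002] E020] [[[E001 E010] E011] E101].
move=> q1_0 q3_0 q1_1 q1_q3 q2E.
have q1_1' : q1 - 1 != 0 by rewrite subr_eq0.
have q1_q3' : q1 - q3 != 0 by rewrite subr_eq0.
have q2_1' : q2 - 1 != 0 by rewrite q2E subr_eq0 invr_eq1.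
have q23_1' : 1 - q3 * q2 != 0.
  rewrite q2E subr_eq0 eq_sym; apply: contraNneq q1_q3.
  by move=> /(canRL (mulfVK q1_0)); rewrite mul1r => ->.
(* Each coefficient equation [w = z] factors as a nonzero [k] times the wanted difference; [ring] or
   [field] checks the factorisation. *)
have eq0E (k u v w z : K) : k != 0 -> w = z -> k * (u - v) = w - z -> u = v.
  move=> k0 ->; rewrite subrr => /eqP; rewrite mulf_eq0 (negPf k0) subr_eq0.
  by move=> /eqP.
pose t1 := b / (q1 - 1); pose t2 := a / (q1 - 1); pose t3 := al / (q2 - 1).
have aE : a = t2 * (q1 - 1) by rewrite divfK.
have bE : b = t1 * (q1 - 1) by rewrite divfK.
have alE : al = t3 * (q2 - 1) by rewrite divfK.
have cE : c = 0 by apply: (eq0E _ _ _ _ _ q23_1' E002); ring.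
have beE : be = 0 by apply: (eq0E _ _ _ _ _ q1_q3' E020); ring.
(* The remaining equations factor only after [c] and [be] have been set to 0 and [a], [b], [al]
   expressed through the [t]s. *)
exists t1, t2, t3; clearbody t1 t2 t3; subst a b al c be q2.
have gaE : ga = t1 * (q1^-1 - 1).
  apply: (eq0E _ _ _ _ _ (mulf_neq0 q3_0 q1_1') E011); field; exact: q1_0.
have muE : mu = t3 * (q3 - 1).
  apply: (eq0E _ _ _ _ _ q1_1' (esym E110)); field; exact: q1_0.
have nuE : nu = t2 * (q3 - 1).
  apply: (eq0E _ _ _ _ _ q2_1' (esym E101)); field; exact: q1_0.
subst ga mu nu.
split; split=> //.
- apply: (eq0E _ _ _ _ _ q23_1' E001); field; exact: q1_0.
- apply: (eq0E _ _ _ _ _ q1_q3' E010); field; exact: q1_0.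
Qed.
End Overlap.

(** * Relations in the shifted and rescaled generators *)

(** The products [(v + t)(u + s)] and [(u + s)(v + t)] exceed [vu] and [uv] by the same [P], so the
    shift subtracts [(q - 1) P] from the [q]-commutator; scaling multiplies it by [l k]. *)
Lemma qcomm_shiftP (K : fieldType) (B : algType K) (u v r : B)
    (q k l s t : K) : k != 0 -> l != 0 ->
  (l *: v + (l * t)%:A) * (k *: u + (k * s)%:A)
    = q *: ((k *: u + (k * s)%:A) * (l *: v + (l * t)%:A)) + (l * k) *: r
  <-> v * u - q *: (u * v) = (q - 1) *: (t *: u + s *: v + (s * t)%:A) + r.
Proof.
move=> k0 l0; set P := t *: u + s *: v + (s * t)%:A.
have vu : (v + t%:A) * (u + s%:A) = v * u + P.
  rewrite mulrDl !mulrDr !mulr_algl mulr_algr scalerA [t * s]mulrC /P.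
  by rewrite -!addrA; congr (_ + _); rewrite addrCA.
have uv : (u + s%:A) * (v + t%:A) = u * v + P.
  by rewrite mulrDl !mulrDr !mulr_algl mulr_algr scalerA /P -!addrA.
rewrite -!scalerA -!scalerDr -!(scalerAl, scalerAr) uv vu.
rewrite !scalerA -[q * k * l]mulrA [k * l]mulrC [q * _]mulrC.
rewrite -[(_ * q) *: _]scalerA -scalerDr.
rewrite scalerBl scale1r [q *: (_ + _)]scalerDr.
split=> [/(scalerI (mulf_neq0 l0 k0)) E|E]; last congr (_ *: _).
  apply: (addIr P); rewrite addrAC E -(addrA (q *: (u * v))) addrC addKr.
  by rewrite [in RHS]addrAC [in RHS]subrK.
rewrite -[v * u](subrK (q *: (u * v))) E [_ - P + r]addrAC.
by rewrite [LHS]addrAC subrK addrC addrA.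
Qed.

(** The two equations on [lam] and [b] say that [lam w1 + b] is [l3 l2] times the remainder
    [la z1 + b3 - t2 t3 (q3 - 1)] of the third relation. *)
Lemma bq_relations_shiftP (K : fieldType) (q1 q2 q3 t1 t2 t3 la b3 lam b : K)
    (l : 'I_3 -> K) (B : algType K) (z w : 'I_3 -> B) :
    (forall i, l i != 0) ->
    lam * l i1 = l i3 * l i2 * la ->
    b + lam * (l i1 * t1) = l i3 * l i2 * (b3 - t2 * t3 * (q3 - 1)) ->
    w i1 = l i1 *: z i1 + (l i1 * t1)%:A ->
    w i2 = l i2 *: z i2 + (l i2 * t2)%:A ->
    w i3 = l i3 *: z i3 + (l i3 * t3)%:A ->
  bq_relations (BQParams q1 q2 q3
      (t2 * (q1 - 1)) (t1 * (q1 - 1)) 0 (t1 * t2 * (q1 - 1))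
      (t3 * (q2 - 1)) 0 (t1 * (q2 - 1)) (t1 * t3 * (q2 - 1))
      la (t3 * (q3 - 1)) (t2 * (q3 - 1)) b3) z <->
  [/\ w i2 * w i1 = q1 *: (w i1 * w i2),
      w i3 * w i1 = q2 *: (w i1 * w i3)
    & w i3 * w i2 = q3 *: (w i2 * w i3) + lam *: w i1 + b%:A].
Proof.
move=> l0 lamE bE w1 w2 w3; rewrite /bq_relations /= !scale0r !addr0.
have rel0 (q s t : K) (u v : B) :
    (t * (q - 1)) *: u + (s * (q - 1)) *: v + (s * t * (q - 1))%:A
      = (q - 1) *: (t *: u + s *: v + (s * t)%:A).
  by rewrite !scalerDr !scalerA ![(q - 1) * _]mulrC.
have E12 := qcomm_shiftP (z i1) (z i2) 0 q1 t1 t2 (l0 i1) (l0 i2).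
have E13 := qcomm_shiftP (z i1) (z i3) 0 q2 t1 t3 (l0 i1) (l0 i3).
have E23 := qcomm_shiftP (z i2) (z i3)
  (la *: z i1 + (b3 - t2 * t3 * (q3 - 1))%:A) q3 t2 t3 (l0 i2) (l0 i3).
rewrite !scaler0 !addr0 -!w1 -!w2 -!w3 in E12 E13.
rewrite -!w2 -!w3 in E23.
have r23 : lam *: w i1 + b%:A
    = (l i3 * l i2) *: (la *: z i1 + (b3 - t2 * t3 * (q3 - 1))%:A).
  by rewrite w1 !scalerDr !scalerA lamE -bE -addrA -scalerDl [_ + b]addrC.
have s23 : la *: z i1
      + (t3 * (q3 - 1)) *: z i2 + (t2 * (q3 - 1)) *: z i3 + b3%:A
    = (q3 - 1) *: (t3 *: z i2 + t2 *: z i3 + (t2 * t3)%:A)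
      + (la *: z i1 + (b3 - t2 * t3 * (q3 - 1))%:A).
  rewrite [(b3 - _)%:A]scalerBl !scalerDr !scalerA ![(q3 - 1) * _]mulrC.
  rewrite [RHS]addrC -!addrA; congr (_ + _); set C := (t2 * t3 * _)%:A.
  by rewrite [_ *: z i2 + (_ + C)]addrA [- C + _]addrC addrK [LHS]addrA addrC.
rewrite s23 !rel0 -[_ + _ + b%:A]addrA r23.
by split=> -[/E12 r12 /E13 r13 /E23 r32].
Qed.

Theorem theorem1p9 (K : fieldType) (A : algType K) (x : 'I_3 -> A)
    (p : bq_params K) (hA : biquadratic p x)
    (hq1 : q1 p != 1) (hq2 : q2 p != 1) (hq3 : q3 p != 1)
    (hq13 : q1 p - q3 p != 0) (hq12 : 1 - q1 p * q2 p = 0) :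
  1 - q2 p * q3 p != 0 /\
  exists (y : 'I_3 -> A) (lam b : K),
    [/\ G3_change x y,
        lam = 0 \/ lam = 1,
        b = 0 \/ b = 1,
        presented_by (fun (B : algType K) (z : 'I_3 -> B) =>
          [/\ z i2 * z i1 = q1 p *: (z i1 * z i2),
              z i3 * z i1 = (q1 p)^-1 *: (z i1 * z i3)
            & z i3 * z i2 = q3 p *: (z i2 * z i3) + lam *: z i1 + b%:A]) y
      & pbw_basis y].
Proof.
case: p hA hq1 hq2 hq3 hq13 hq12.
move=> q1 q2 q3 a b c b1 al be ga b2 la mu nu b3 /= [[q10 _ q30] pres hx].
rewrite /= in q10 q30.
move=> hq1 _ _ hq13 /eqP; rewrite subr_eq0 eq_sym => /eqP q12.
have q2E : q2 = q1^-1 by apply: (mulfI q10); rewrite q12 divff.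
have q1_q3 : q1 != q3 by rewrite -subr_eq0.
split.
  rewrite q2E subr_eq0; apply: contraNneq q1_q3 => E.
  by rewrite -[q1]mulr1 E mulrA divff ?mul1r.
have [t1 [t2 [t3 [[aE bE cE b1E] [alE beE gaE b2E] [muE nuE]]]]] :=
  overlap_params hx pres.1 q10 q30 hq1 q1_q3 q2E.
subst a b c b1 al be ga b2 mu nu q2.
(* In terms of [x1 + t1] the remainder of the third relation is [la (x1 + t1) + b3']. *)
set b3' := b3 - t2 * t3 * (q3 - 1) - la * t1.
(* With second scale 1, the new constant is [l3 b3'] and the new [lam] is [l3 la / l1]. So [l3]
   normalises the constant first, then [l1] normalises [lam]; the default 1 keeps the scales
   invertible. *)
pose l3 : K := if b3' == 0 then 1 else b3'^-1.
pose l1 : K := if la == 0 then 1 else l3 * la.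
pose l (i : 'I_3) : K := nth 1 [:: l1; 1; l3] i.
pose m (i : 'I_3) : K := l i * nth 0 [:: t1; t2; t3] i.
have l3_0 : l3 != 0.
  by rewrite /l3; have [_|b0] := eqVneq b3' 0; rewrite ?oner_neq0 ?invr_eq0.
have l0 i : l i != 0.
  case: i => [[|[|[|//]]] lt_i]; rewrite /l /= ?oner_neq0 // /l1.
  by have [_|la0] := eqVneq la 0; rewrite ?oner_neq0 // mulf_neq0.
exists (fun i => l i *: x i + (m i)%:A), (la != 0)%:R, (b3' != 0)%:R.
split; last exact: pbw_basis_affine.
- exact: G3_affine (G3_id x) l0.
- by case: eqP; [left|right].
- by case: eqP; [left|right].
have b3'E : (b3' != 0)%:R = l3 * b3'.
  by rewrite /l3; have [->|b0] := eqVneq b3' 0; rewrite ?mulr0 // mulVf.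
have laE : (la != 0)%:R * l1 = l3 * la.
  by rewrite /l1; have [->|la0] := eqVneq la 0; rewrite ?mulr0 ?mul0r ?mul1r.
apply: (presented_by_affine l0 _ pres) => B z w wE.
apply: (@bq_relations_shiftP _ _ _ _ _ _ _ _ _ _ _ l _ _ _ l0); try exact: wE.
  by rewrite /l /= mulr1.
by rewrite /l /= mulrA laE b3'E /b3'; ring.
Qed.
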